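(* Let $d\ge 1$, let $V\subset\mathbb{R}^d$ be a neighborhood of the origin, and let $\phi:V\to[0,\infty)$ be an arbitrary non-negative real-valued function, extended to $\mathbb{R}^d$ by $\phi(\lambda)=+\infty$ for $\lambda\notin V$. Let $\xi=(\xi(1),\dots,\xi(d))$ be a centered (mean zero) random vector such that $$\max_{\epsilon\in\{-1,1\}^d}\mathbf{E}\exp\Big(\sum_{j=1}^d\epsilon(j)\lambda(j)\xi(j)\Big)\le e^{\phi(\lambda)}\qquad\text{for all }\lambda\in V .$$ Then for every vector $x\in\mathbb{R}^d$ with non-negative coordinates, $$U(\xi,x)\le\exp\left(-\phi^*(x)\right).$$
   Context: The tail function of a random vector $\xi=(\xi(1),\dots,\xi(d))$ at a vector $x$ with $x(j)\ge0$ is $$U(\xi,x)=\max_{\epsilon\in\{-1,1\}^d}\mathbf{P}\big(\epsilon(1)\xi(1)>x(1),\ \dots,\ \epsilon(d)\xi(d)>x(d)\big).$$ The Young–Fenchel (Legendre) transform is $\phi^*(x)=\sup_{\lambda:\ \phi(\lambda)<\infty}\big((x,\lambda)-\phi(\lambda)\big)$, where $(x,\lambda)=\sum_{j=1}^d x(j)\lambda(j)$. Here $e^{-\infty}=0$. *)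

(* Defs.v *)
From HB Require Import structures.
From mathcomp Require Import all_boot all_order all_algebra.
From mathcomp Require Import all_classical all_reals all_analysis.

Set Implicit Arguments.
Unset Strict Implicit.
Unset Printing Implicit Defensive.

Import Order.TTheory GRing.Theory Num.Theory.
Import numFieldNormedType.Exports.

Local Open Scope classical_set_scope.
Local Open Scope ring_scope.
Local Open Scope ereal_scope.

(* A sign vector in {-1,1}^d is encoded by s : {ffun 'I_d -> bool}. *)
Definition sgn_coord (R : realType) (d : nat) (s : {ffun 'I_d -> bool})
  (j : 'I_d) : R := ((-1) ^+ s j)%R.

(* The maximum over {-1,1}^d; this set is nonempty, so the base value -oo is
   never the maximum unless F is identically -oo. *)
Definition max_signs (R : realType) (d : nat)
  (F : {ffun 'I_d -> bool} -> \bar R) : \bar R :=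
  \big[maxe/-oo]_(s : {ffun 'I_d -> bool}) F s.

Definition dotv (R : realType) (d : nat) (x lambda : 'rV[R]_d) : R :=
  (\sum_(j < d) x 0 j * lambda 0 j)%R.

Definition tail_function (dT : measure_display) (T : measurableType dT)
  (R : realType) (P : probability T R) (d : nat) (xi : 'I_d -> {RV P >-> R})
  (x : 'rV[R]_d) : \bar R :=
  max_signs (fun s =>
    P [set w | forall j : 'I_d, (x 0 j < sgn_coord R s j * xi j w)%R]).

(* Integrability is part of being centered: the integral of the library is
   also defined for functions that are not integrable. *)
Definition centered (dT : measure_display) (T : measurableType dT)
  (R : realType) (P : probability T R) (d : nat)
  (xi : 'I_d -> {RV P >-> R}) : Prop :=
  forall j : 'I_d,
    P.-integrable setT (EFin \o (xi j : T -> R)) /\ 'E_P[xi j] = 0.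

Definition extend_pinfty (R : realType) (d : nat) (V : set 'rV[R]_d)
  (phi : 'rV[R]_d -> R) (lambda : 'rV[R]_d) : \bar R :=
  if lambda \in V then (phi lambda)%:E else +oo.

Definition young_fenchel (R : realType) (d : nat) (f : 'rV[R]_d -> \bar R)
  (x : 'rV[R]_d) : \bar R :=
  ereal_sup [set (dotv x lambda)%:E - f lambda
            | lambda in [set lambda | f lambda < +oo]].

(* Main.v *)
(* Chernoff's bound: Markov's inequality applied to the exponential moment at
   lambda bounds P(A) by exp(phi(lambda) - (x, lambda)), and the infimum over
   lambda in V gives the theorem. Negative coordinates of lambda are absorbed
   into the choice of signs. *)
Require Import Defs.
From HB Require Import structures.
From mathcomp Require Import all_boot all_order all_algebra.
From mathcomp Require Import all_classical all_reals all_analysis.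
From mathcomp Require Import measurable_realfun.

Set Implicit Arguments.
Unset Strict Implicit.
Unset Printing Implicit Defensive.

Import Order.TTheory GRing.Theory Num.Theory.
Import numFieldNormedType.Exports.

Local Open Scope classical_set_scope.
Local Open Scope ring_scope.
Local Open Scope ereal_scope.

(** Markov's inequality for the exponential: on [A] the constant [expR c] is below [expR (Y w)],
    whose integral only grows from [A] to the whole space by positivity. *)
Lemma expectation_expR_markov (R : realType) (dT : measure_display)
  (T : measurableType dT) (P : probability T R) (A : set T) (Y : T -> R)
  (c : R) : measurable A -> measurable_fun setT Y ->
  (forall w, A w -> (c <= Y w)%R) ->
  (expR c)%:E * P A <= 'E_P[fun w => expR (Y w)].
Proof.
move=> mA mY cY.
have mE : measurable_fun setT (fun w => (expR (Y w))%:E).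
  by apply/measurable_EFinP; apply: measurableT_comp.
rewrite expectation.unlock -integral_cst//.
apply: (@le_trans _ _ (\int[P]_(w in A) (expR (Y w))%:E)); last first.
  by apply: ge0_subset_integral => // w _; rewrite lee_fin expR_ge0.
apply: ge0_le_integral => //.
- by move=> w _; rewrite lee_fin expR_ge0.
- exact: measurable_funTS.
- by move=> w Aw; rewrite lee_fin ler_expR cY.
Qed.

Lemma measurable_orthant (R : realType) (dT : measure_display)
  (T : measurableType dT) (I : finType) (f : I -> T -> R) (x : I -> R) :
  (forall i, measurable_fun setT (f i)) ->
  measurable [set w | forall i, (x i < f i w)%R].
Proof.
move=> mf; rewrite (_ : mkset _ = \bigcap_(i in setT) (f i @^-1` `]x i, +oo[)).
  apply: fin_bigcap_measurable => // i _.
  by rewrite -[X in measurable X]setTI; apply: mf.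
by apply/seteqP; split=> w /= h i => [_|]; have := h i;
  rewrite /= in_itv/= andbT => //; exact.
Qed.

(** Taking [lne] turns the claim into an upper bound on a supremum, which can be checked for one [l]
    at a time. *)
Lemma le_expeRN_young_fenchel (R : realType) (d : nat)
  (f : 'rV[R]_d -> \bar R) (x : 'rV[R]_d) (p : \bar R) : 0 <= p ->
  (forall l, f l < +oo -> p <= expeR (f l - (dotv x l)%:E)) ->
  p <= expeR (- young_fenchel f x).
Proof.
(* This covers [p = 0] too, through the value [-oo] of the logarithm. *)
move=> p0 pf; have pK : expeR (lne p) = p by apply/eqP; rewrite lneK_eq.
rewrite -pK lee_expeR leeNr; apply: ge_ereal_sup => _ [l /= fl <-].
(* The opposite distributes even if [f l] is infinite, since [dotv x l] is finite. *)
rewrite leeNr oppeB ?fin_num_adde_defr//.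
by rewrite -[(_ <= _)%O]lee_expeR pK addeC; exact: pf.
Qed.

Theorem proposition2p1 (R : realType) (dT : measure_display)
  (T : measurableType dT) (P : probability T R)
  (d : nat) (hd : (1 <= d)%N)
  (V : set 'rV[R]_d) (hV : nbhs (0%R : 'rV[R]_d) V)
  (phi : 'rV[R]_d -> R)
  (phi_ge0 : forall lambda, V lambda -> (0 <= phi lambda)%R)
  (xi : 'I_d -> {RV P >-> R}) (xi_centered : centered xi)
  (hphi : forall lambda, V lambda ->
    max_signs (fun s =>
      'E_P[fun w => expR
             (\sum_(j < d) sgn_coord R s j * lambda 0%R j * xi j w)%R])
    <= (expR (phi lambda))%:E)
  (x : 'rV[R]_d) (x_ge0 : forall j, (0 <= x 0%R j)%R) :
  tail_function xi x <= expeR (- young_fenchel (extend_pinfty V phi) x).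
Proof.
apply: bigmax_le => [|s _]; first exact: leNye.
apply: le_expeRN_young_fenchel => // l; rewrite /extend_pinfty.
case: ifPn => [/set_mem Vl _|_]; last by rewrite ltxx.
(* Flipping the signs of s where l is negative replaces l by its absolute
   value in the exponential moment, and (x, l) <= (x, |l|). *)
pose s' := [ffun j => s j (+) (l 0%R j < 0)%R].
have s'l j : (sgn_coord R s' j * l 0 j = sgn_coord R s j * `|l 0 j|)%R.
  rewrite /sgn_coord ffunE signr_addb -mulrA; congr (_ * _)%R.
  by rewrite {2}[l 0%R j]realEsign ?num_real// signrMK.
(* Clearing the denominator leaves Markov's inequality with [c = dotv x l]. *)
rewrite -EFinB [expeR _]/= expRB EFinM lee_pdivlMr ?expR_gt0// muleC.
(* The moment bound is used at [s'], while the tail event keeps the signs [s]. *)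
apply: le_trans (le_trans (le_bigmax _ _ s') (hphi l Vl)).
apply: expectation_expR_markov.
- apply: measurable_orthant => j.
  by apply: measurable_funM.
- by apply: measurable_sum => j; apply: measurable_funM.
(* In each coordinate, [x 0 j * l 0 j] is at most [x 0 j] times the absolute value of [l 0 j]
   because [x 0 j] is non-negative; the event then bounds [x 0 j] by the signed [xi j w]. *)
- move=> w /= xw; apply: ler_sum => j _.
  rewrite s'l mulrAC; apply: (@le_trans _ _ (x 0 j * `|l 0 j|)%R).
    by rewrite ler_wpM2l ?ler_norm.
  by rewrite ler_wpM2r// ltW.
Qed.
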